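(* Let $p$ be a prime, $m$ a positive integer, $q=p^m$ with $q>2$, $n=q^2+1$. Let $\mathcal{C}$ be either (i) for $\lambda\in\mathbb{F}_{q^2}^*$ of order $r$ with $r\mid(q+1)$, $\nu_2(r)=\nu_2(q+1)$, the $\lambda$-constacyclic code $\mathcal{C}(1,q^2+q+1)$ of length $n$ over $\mathbb{F}_{q^2}$ with check polynomial $(x-\delta)(x-\delta^{q^2})(x-\delta^{q^2+q+1})(x-\delta^{q^4+q^3+q^2})$, or (ii) for $\lambda\in\mathbb{F}_{q^2}^*$ of order $r$ with $r\mid(q-1)$, $\nu_2(r)=\nu_2(q-1)$, the $\lambda$-constacyclic code $\mathcal{C}(1,q^2-q+1)$ of length $n$ over $\mathbb{F}_{q^2}$ with check polynomial $(x-\delta)(x-\delta^{q^2})(x-\delta^{q^2-q+1})(x-\delta^{q^4-q^3+q^2})$; here $\delta\in\mathbb{F}_{q^4}$ is a primitive $rn$-th root of unity with $\delta^n=\lambda$. Then the dual code $\mathcal{C}^\perp$, viewed as an LRC over $\mathbb{F}_{q^2}$ with its (minimum) locality, is both distance-optimal and dimension-optimal.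
   Context: $\nu_2$ is the $2$-adic valuation. A coordinate $i$ of a linear code has locality $r_l$ if in every codeword the $i$-th symbol is a function of some fixed $r_l$ other symbols; a code has locality $r_l$ if every coordinate has locality at most $r_l$. An $(n,k,d,Q;r_l)$-LRC is a linear $[n,k,d]$ code over $\mathbb{F}_Q$ with locality $r_l$. It is distance-optimal if $d=n-k-\lceil k/r_l\rceil+2$ (Singleton-like bound), and dimension-optimal if $k=\min_{t\in\mathbb{Z}_{\ge0}}\{t r_l+k^{(Q)}_{\mathrm{opt}}(n-t(r_l+1),d)\}$ (Cadambe–Mazumdar bound), where $k^{(Q)}_{\mathrm{opt}}(N,d)$ is the largest dimension of a $Q$-ary linear code of length $N$ and minimum distance $d$. *)

(* Defs.v *)
From HB Require Import structures.
From mathcomp Require Import all_boot all_order all_algebra all_field.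
Set Implicit Arguments. Unset Strict Implicit. Unset Printing Implicit Defensive.
Import Order.TTheory GRing.Theory.
Local Open Scope ring_scope.

Section Codes.
Variable F : finFieldType.

Definition wt N (c : 'rV[F]_N) : nat := #|[set i | c 0 i != 0]|.

Definition linear_code N (C : {set 'rV[F]_N}) : bool :=
  (0 \in C) && [forall a : F, [forall x in C, [forall y in C, a *: x + y \in C]]].

Definition code_dim N (C : {set 'rV[F]_N}) : nat := \dim <<enum C>>%VS.

Definition is_min_dist N (C : {set 'rV[F]_N}) (d : nat) : Prop :=
  (exists2 c, c \in C & (c != 0) /\ wt c = d) /\
  (forall c, c \in C -> c != 0 -> (d <= wt c)%N).

Definition dual_code N (C : {set 'rV[F]_N}) : {set 'rV[F]_N} :=
  [set x | [forall c in C, (x *m c^T) 0 0 == 0]].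

Definition has_locality N (C : {set 'rV[F]_N}) (rl : nat) : Prop :=
  forall i : 'I_N, exists R : {set 'I_N},
    [/\ i \notin R, (#|R| <= rl)%N &
        forall c c', c \in C -> c' \in C ->
          (forall j, j \in R -> c 0 j = c' 0 j) -> c 0 i = c' 0 i].

Definition is_min_locality N (C : {set 'rV[F]_N}) (rl : nat) : Prop :=
  has_locality C rl /\ forall r', has_locality C r' -> (rl <= r')%N.

Definition kopt (N d : nat) : nat :=
  \max_(C : {set 'rV[F]_N} | linear_code C &&
          [forall c in C, (c != 0) ==> (d <= wt c)%N]) code_dim C.

Definition ceil_div (a b : nat) : nat := (a + b - 1) %/ b.

(* Singleton-like bound met with equality *)
Definition distance_optimal (n k d rl : nat) : Prop :=
  (d%:Z = n%:Z - k%:Z - (ceil_div k rl)%:Z + 2)%R.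

(* Cadambe--Mazumdar bound met with equality:
   k = min_{t >= 0} { t rl + kopt (n - t (rl+1)) d } *)
Definition dimension_optimal (n k d rl : nat) : Prop :=
  (exists t : nat, k = (t * rl + kopt (n - t * rl.+1) d)%N) /\
  (forall t : nat, (k <= t * rl + kopt (n - t * rl.+1) d)%N).

End Codes.

(* lambda-constacyclic code of length n over F with check polynomial h
   (h has coefficients in the extension L, h | x^n - lambda):
   generator g = (x^n - lambda)/h, C = { c : g | c(x) } *)
Definition constacyclic_code (F : finFieldType) (L : fieldExtType F) (n : nat)
    (lam : F) (h : {poly L}) : {set 'rV[F]_n} :=
  let g := ('X^n - (lam%:A)%:P) %/ h in
  [set c : 'rV[F]_n | g %| map_poly (in_alg L) (rVpoly c)].

Definition check_poly (F : fieldType) (L : fieldExtType F) (delta : L)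
    (q a b : nat) : {poly L} :=
  ('X - delta%:P) * ('X - (delta ^+ (q ^ 2))%:P) *
  ('X - (delta ^+ a)%:P) * ('X - (delta ^+ b)%:P).

(* Main.v *)
(* Let [y = delta^-1]. The check polynomial has roots [(y * om ^+ e)^-1], [e = 0, 1, q, q + 1], for a
   primitive [n]-th root of unity [om]. Hence the words of C are, up to the nonzero factors [y ^+ i],
   the values at the powers [om ^+ i] of the polynomials
     [P(A, B) = A + B X + B^(q^2) X^q + A^(q^2) X^(q + 1)],  A and B in L.
   (Up to equivalence, C is the elliptic quadric code over F_q with scalars extended to F_(q^2).)
   A nonzero [P(A, B)] has at most [q + 1] roots, and [P(w, w^q)] divides [X^n - 1] for generic [w],
   so the least weight of C is [q^2 - q], attained by words that are nonzero at any given position: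
   the minimum locality of the dual is [q^2 - q - 1]. Products [(X - a) (X - b)^q] show that the dual
   has distance at least 4, and shortening it at the [q + 1] zeros of a minimum weight word of C gives
   a [q + 1, q - 2, 4] MDS code. The latter provides words of weight 4 and equality at [t = 1] in the
   Cadambe-Mazumdar bound. *)
Require Import Defs.
From HB Require Import structures.
From mathcomp Require Import all_boot all_order all_algebra all_field.
From mathcomp Require Import zify ring.
Import GRing.Theory.
Local Open Scope ring_scope.

(** * Linear codes, the Singleton bound and parity-check codes *)

Lemma linear_codeP (F : finFieldType) N (C : {set 'rV[F]_N}) :
  reflect (0 \in C /\ forall (a : F) x y, x \in C -> y \in C -> a *: x + y \in C)
          (linear_code C).
Proof.
apply: (iffP andP) => -[C0 CL]; split=> //.
  by move=> a x y xC yC; move/forallP/(_ a)/forall_inP/(_ x xC)/forall_inP: CL; apply.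
by apply/forallP=> a; apply/forall_inP=> x xC; apply/forall_inP=> y; apply: CL.
Qed.

Lemma span_linear_code (F : finFieldType) N (C : {set 'rV[F]_N}) (x : 'rV[F]_N) :
  linear_code C -> (x \in <<enum C>>%VS) = (x \in C).
Proof.
move=> /linear_codeP[C0 CL]; apply/idP/idP; last by rewrite -mem_enum; apply: memv_span.
rewrite -[enum C]in_tupleE => /coord_span ->.
apply: (big_ind (fun z => z \in C)) => // [y z yC zC|i _].
  by rewrite -[y]scale1r CL.
rewrite -[_ *: _]addr0 CL //= -mem_enum mem_nth //.
Qed.

(** Restriction to the first [N.+1 - d] coordinates is injective on [C], since a word vanishing
    there has weight less than [d]. *)
Lemma singleton_bound (F : finFieldType) N (C : {set 'rV[F]_N}) d :
  linear_code C -> (0 < d)%N ->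
  (forall c, c \in C -> c != 0 -> (d <= wt c)%N) ->
  (code_dim C <= N.+1 - d)%N.
Proof.
move=> linC d_gt0 dC.
have leN : (N.+1 - d <= N)%N by lia.
pose f := linfun (fun x : 'rV[F]_N => colsub (widen_ord leN) x).
have capf : (<<enum C>> :&: lker f)%VS = 0%VS.
  apply/eqP; rewrite -subv0; apply/subvP=> x.
  rewrite memv_cap span_linear_code // memv_ker lfunE /= => /andP[xC /eqP/rowP x0].
  rewrite memv0; apply: contraT => /(dC _ xC).
  rewrite leqNgt => /negP[].
  have sub : [set widen_ord leN j | j in 'I_(N.+1 - d)] \subset ~: [set i | x 0 i != 0].
    by apply/subsetP=> _ /imsetP[j _ ->]; move: (x0 j); rewrite !inE !mxE => ->; rewrite eqxx.
  move: (subset_leq_card sub) (cardsC [set i | x 0 i != 0]).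
  rewrite card_imset => [|j k [/val_inj]] //; rewrite !card_ord /wt; move: #|_| #|_| => a b; lia.
rewrite /code_dim -(limg_dim_eq capf).
apply: leq_trans (dimvS (subvf _)) _.
by rewrite dimvf /dim /= mul1n.
Qed.

(** The dual of the code spanned by the columns of [H]; the words of the latter are the columns
    [H *m u]. *)
Definition parity_code {F : finFieldType} {N s} (H : 'M[F]_(N, s)) : {set 'rV[F]_N} :=
  [set x | x *m H == 0].

Lemma linear_parity_code (F : finFieldType) N s (H : 'M[F]_(N, s)) :
  linear_code (parity_code H).
Proof.
apply/linear_codeP; split=> [|a x y]; rewrite !inE ?mul0mx //.
by move=> /eqP xH /eqP yH; rewrite mulmxDl -scalemxAl xH yH scaler0 addr0.
Qed.

Lemma code_dim_parity_code (F : finFieldType) N s (H : 'M[F]_(N, s)) :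
  code_dim (parity_code H) = (N - \rank H)%N.
Proof.
(* Passing to the column base of [H] keeps the kernel and makes the map surjective. *)
pose B := col_base H; pose f := linfun (fun x : 'rV_N => mulmxr B x).
have fullB : row_full B by exact: col_base_full.
have -> : code_dim (parity_code H) = \dim (lker f).
  congr (\dim _); apply/vspaceP=> x.
  rewrite span_linear_code ?linear_parity_code // memv_ker lfunE /= inE.
  rewrite -{1}[H]mulmx_base mulmxA; apply/eqP/eqP=> [|->]; last by rewrite mul0mx.
  by move=> /eqP; rewrite mulmx_free_eq0 ?row_base_free // => /eqP.
have := limg_ker_dim f fullv; rewrite capfv.
have -> : (f @: fullv)%VS = fullv.
  apply/eqP; rewrite eqEsubv subvf; apply/subvP=> y _.
  have /submxP[z ->] : (y <= B)%MS by exact: submx_full.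
  by apply/memv_imgP; exists z; rewrite ?memvf // lfunE.
by rewrite !dimvf /dim /= !mul1n => /(canRL (addnK _)).
Qed.

(** Right multiplication by [rowsub f 1%:M] extends [x] by zero along [f]. *)
Lemma wt_reindex (F : finFieldType) M N (f : 'I_M -> 'I_N) (x : 'rV[F]_M) :
  injective f -> wt (x *m rowsub f 1%:M) = wt x.
Proof.
move=> inj_f; rewrite /wt -(card_imset _ inj_f); apply: eq_card => i.
have xf j : (x *m rowsub f 1%:M) 0 (f j) = x 0 j.
  rewrite mxE (bigD1 j) //= !mxE eqxx mulr1 big1 ?addr0 // => k nkj.
  by rewrite !mxE inj_eq // (negbTE nkj) mulr0.
apply/idP/imsetP => [|[j]]; rewrite !inE; last by move=> xj ->; rewrite xf.
move=> xi; have [/existsP[j /eqP fj]|/existsPn nof] := boolP [exists j, f j == i].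
  by exists j; rewrite // inE -xf fj.
by case/eqP: xi; rewrite mxE big1 // => j _; rewrite !mxE (negbTE (nof j)) mulr0.
Qed.

(** * Locality from the zeros of the words [H *m u] *)

Section FewZeros.
Variables (F : finFieldType) (N s t : nat) (H : 'M[F]_(N, s)).
Hypothesis zeros_le : forall u : 'cV_s, u != 0 -> (#|[set i | (H *m u) i 0%R == 0%R]| <= t)%N.

(** A nonzero vector orthogonal to the rows in [T] would give a word [H *m u] with more than [t]
    zeros. Rows outside [T] are zeroed rather than deleted, so that combinations stay indexed by all
    positions. *)
Lemma row_full_restricted (T : {set 'I_N}) : (t < #|T|)%N ->
  row_full (\matrix_(i < N) (if i \in T then row i H else 0)).
Proof.
move=> ltT; rewrite -[row_full _]/(_ == _) -mxrank_tr; apply: inj_row_free => v.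
set HT := \matrix_i _ => vHT; apply: contraTeq ltT => v0.
rewrite -leqNgt; have /zeros_le : v^T != 0 by rewrite trmx_eq0.
apply: leq_trans.
apply/subset_leq_card/subsetP=> i iT; rewrite inE.
have /rowP/(_ i) := vHT; rewrite mxE [RHS]mxE => <-; rewrite mxE; apply/eqP.
by apply: eq_bigr => j _; rewrite !mxE iT !mxE mulrC.
Qed.

(** For smaller [r], more than [t] positions lie outside [i |: R], so row [i] of [H] is a
    combination of the rows there. *)
Lemma parity_code_locality_ge r : (0 < N)%N ->
  has_locality (parity_code H) r -> (N - t.+1 <= r)%N.
Proof.
move=> N_gt0 /(_ (Ordinal N_gt0)); set i := Ordinal _ => -[R [iR leR locR]].
rewrite leqNgt; apply/negP=> ltr.
pose T := ~: (i |: R).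
have ltT : (t < #|T|)%N.
  move: (cardsC (i |: R)); rewrite cardsU1 iR card_ord -/T => cT; move: #|T| cT => cT; move: #|R| leR => cR; lia.
have /submxP[v vE] := submx_full (row i H) (row_full_restricted _ ltT).
(* This word is 1 at [i] but agrees with the zero word on [R], so [R] does not determine the symbol
   at [i]. *)
pose x : 'rV[F]_N := delta_mx 0 i - \row_j (if j \in T then v 0 j else 0).
have xK : x \in parity_code H.
  rewrite inE mulmxBl -rowE vE subr_eq0; apply/eqP/rowP=> k; rewrite !mxE.
  by apply: eq_bigr => j _; rewrite !mxE; case: (j \in T); rewrite ?mxE ?mulr0 ?mul0r.
have: x 0 i = (0 : 'rV_N) 0 i.
  apply: locR => // [|j jR]; first by rewrite inE mul0mx.
  have /negbTE nji : j != i by apply: contraNneq iR => <-.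
  by rewrite !mxE !inE jR nji /= subr0.
by rewrite !mxE !inE !eqxx /= subr0 => /eqP; rewrite oner_eq0.
Qed.

Lemma mxrank_parity_check : (t < N)%N -> \rank H = s.
Proof.
move=> ltN; rewrite -mxrank_tr; apply/eqP/inj_row_free => v vH.
apply: contraTeq ltN => v0; rewrite -leqNgt -[N]card_ord -cardsT.
have /zeros_le : v^T != 0 by rewrite trmx_eq0.
apply: leq_trans; apply/subset_leq_card/subsetP=> i _.
by rewrite inE -[H *m _]trmxK trmx_mul trmxK vH !mxE.
Qed.

End FewZeros.

(** A word [H *m u] that is nonzero at [i] is a parity check through [i]; its other nonzero
    positions recover the symbol at [i]. *)
Lemma parity_code_locality (F : finFieldType) N s t (H : 'M[F]_(N, s)) :
  (forall i, exists u : 'cV_s, (H *m u) i 0%R != 0 /\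
     (t <= #|[set i | (H *m u) i 0%R == 0%R]|)%N) ->
  has_locality (parity_code H) (N - t.+1).
Proof.
move=> exu i; have [u [ui zu]] := exu i.
have uK c : c \in parity_code H -> c *m (H *m u) = 0.
  by rewrite inE mulmxA => /eqP ->; rewrite mul0mx.
move: (H *m u) uK ui zu => w wK wi zw.
pose S := [set j | w j 0%R != 0%R].
exists (S :\ i); split; first by rewrite !inE eqxx.
  have iS : i \in S by rewrite inE.
  move: (cardsD1 i S) (cardsC S); rewrite iS card_ord.
  have -> : ~: S = [set i | w i 0%R == 0%R] by apply/setP=> j; rewrite !inE negbK.
  move: #|S :\ i| #|S| #|_| zw => a b c; lia.
move=> c c' cK c'K eqR.
have: (c - c') *m w = 0 by rewrite mulmxBl !wK ?subr0.
move=> /rowP/(_ 0); rewrite mxE (bigD1 i) //= big1 => [|j nji].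
  by rewrite addr0 !mxE => /eqP; rewrite mulf_eq0 (negbTE wi) orbF subr_eq0 => /eqP.
have [/eqP ->|wj] := boolP (w j 0 == 0); first by rewrite mulr0.
by rewrite !mxE eqR ?subrr ?mul0r // !inE nji.
Qed.

(** * Shortened codes and bounds on [kopt] *)

(** Keeping only [t] zeros of [H *m u] puts [u] in the kernel of the remaining check matrix, whose
    rank is thus below [s]. *)
Lemma shortened_parity_code (F : finFieldType) N s t (H : 'M[F]_(N, s)) (u : 'cV_s) :
  u != 0 -> (t <= #|[set i | (H *m u) i 0%R == 0%R]|)%N ->
  exists f : 'I_t -> 'I_N, injective f /\ (t < code_dim (parity_code (rowsub f H)) + s)%N.
Proof.
move=> u0 leZ; set Z := [set i | _] in leZ.
pose f (j : 'I_t) : 'I_N := enum_val (widen_ord leZ j).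
exists f; split=> [j k /enum_val_inj[/val_inj]//|//].
rewrite code_dim_parity_code.
have: rowsub f H *m u = 0.
  apply/colP=> j; rewrite mul_rowsub_mx !mxE.
  by have := enum_valP (widen_ord leZ j); rewrite inE mxE => /eqP.
have lu : (0 < \rank u)%N by rewrite lt0n mxrank_eq0.
move=> /mulmx0_rank_max; lia.
Qed.

Lemma kopt_le_singleton (F : finFieldType) t d : (0 < d)%N -> (kopt F t d <= t.+1 - d)%N.
Proof.
move=> d_gt0; apply/bigmax_leqP => C /andP[linC /forall_inP dC].
by apply: singleton_bound => // c cC; apply/implyP; apply: dC.
Qed.

Lemma leq_kopt (F : finFieldType) N d (C : {set 'rV[F]_N}) : linear_code C ->
  (forall c, c \in C -> c != 0 -> (d <= wt c)%N) -> (code_dim C <= kopt F N d)%N.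
Proof.
move=> linC dC; apply: (@leq_bigmax_cond _ _ (@code_dim F N) C).
by rewrite linC; apply/forall_inP=> c cC; apply/implyP; apply: dC.
Qed.

(** * Optimality of a code with the zero counts of an ovoid *)

Section OvoidCode.
Variables (F : finFieldType) (q s : nat).
Let n := (q ^ 2 + 1)%N.
Variable H : 'M[F]_(n, s).
Hypothesis s4 : s = 4%N.
Hypothesis q_gt2 : (2 < q)%N.
Hypothesis zeros_le : forall u : 'cV_s, u != 0 ->
  (#|[set i | (H *m u) i 0%R == 0%R]| <= q.+1)%N.
Hypothesis zeros_ge : forall i, exists u : 'cV_s, (H *m u) i 0%R != 0 /\
  (q.+1 <= #|[set i | (H *m u) i 0%R == 0%R]|)%N.
Hypothesis wt_ge4 : forall x, x \in parity_code H -> x != 0 -> (4 <= wt x)%N.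
Let K := parity_code H.

Lemma code_dim_ovoid : code_dim K = (q ^ 2 - 3)%N.
Proof.
rewrite code_dim_parity_code (mxrank_parity_check _ _ _ _ _ zeros_le) /n; last by nia.
by lia.
Qed.

(** [E] consists of the words of [K] supported on [q + 1] zeros of some [H *m u]. Extension by zero,
    the last clause, carries the bound [wt_ge4] over to [E] and words of small weight back to
    [K]. *)
Lemma ovoid_section : exists E : {set 'rV[F]_q.+1},
  [/\ linear_code E, (q - 2 <= code_dim E)%N &
     forall c, c \in E -> c != 0 -> exists2 c', c' \in K & c' != 0 /\ wt c' = wt c].
Proof.
have n_gt0 : (0 < n)%N by rewrite /n addn1.
have [u [ui zu]] := zeros_ge (Ordinal n_gt0).
have u0 : u != 0 by apply: contraNneq ui => ->; rewrite mulmx0 mxE.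
have [f [inj_f dimE]] := shortened_parity_code _ _ _ _ _ _ u0 zu.
exists (parity_code (rowsub f H)); split; [exact: linear_parity_code|lia|].
move=> c cE c0; exists (c *m rowsub f 1%:M).
  by move: cE; rewrite !inE -mulmxA -rowsubE.
rewrite wt_reindex //; split=> //; apply: contraNneq c0 => /(congr1 (@wt F n)).
rewrite wt_reindex // /wt.
have -> : [set i | (0 : 'rV[F]_n) 0 i != 0] = set0 by apply/setP=> i; rewrite !inE mxE eqxx.
rewrite cards0 => /eqP; rewrite cards_eq0 => /eqP/setP c0.
by apply/eqP/rowP=> i; move: (c0 i); rewrite !inE mxE => /negbFE/eqP.
Qed.

Lemma ovoid_code_optimal : exists d rl : nat,
  [/\ is_min_dist K d, is_min_locality K rl,
      distance_optimal n (code_dim K) d rl &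
      dimension_optimal F n (code_dim K) d rl].
Proof.
have [E [linE dimE EK]] := ovoid_section.
have n_gt0 : (0 < n)%N by rewrite /n addn1.
have subn_loc : (n - q.+2 = q ^ 2 - q - 1)%N by rewrite /n; nia.
exists 4%N, (q ^ 2 - q - 1)%N; rewrite code_dim_ovoid; split.
- split=> //.
  (* If all nonzero words of [E] had weight at least 5, the Singleton bound would give dimension at
     most [q - 3]. *)
  have /exists_inP[c cE /andP[c0 wc]] : [exists c in E, (c != 0) && (wt c < 5)%N].
    apply: contraLR dimE => /exists_inPn noc; rewrite -ltnNge.
    have: (code_dim E <= q.+2 - 5)%N.
      apply: singleton_bound => // c cE c0; rewrite leqNgt.
      by move: (noc c cE); rewrite c0.
    lia.
  have [c' c'K [c'0 wc']] := EK c cE c0; exists c' => //; split=> //.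
  by apply/eqP; rewrite eqn_leq wt_ge4 // andbT wc' -ltnS.
- split=> [|r' loc]; rewrite -subn_loc; first exact: parity_code_locality.
  exact: (parity_code_locality_ge _ _ _ _ _ zeros_le).
- rewrite /distance_optimal.
  (* The quotient exceeds 1 exactly because [q > 2], and it is at most 2 because [(q - 1)^2] is
     nonnegative. *)
  have -> : ceil_div (q ^ 2 - 3) (q ^ 2 - q - 1) = 2%N.
    rewrite /ceil_div; apply/eqP; rewrite eqn_leq; apply/andP; split.
      rewrite -ltnS ltn_divLR; nia.
    rewrite leq_divRL; nia.
  rewrite /n; nia.
have kE : kopt F q.+1 4 = (q - 2)%N.
  apply/eqP; rewrite eqn_leq; apply/andP; split.
    by have := kopt_le_singleton F q.+1 4 isT; lia.
  apply: leq_trans dimE (leq_kopt _ _ _ _ linE _) => c cE c0.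
  by have [c' c'K [c'0 <-]] := EK c cE c0; apply: wt_ge4.
have nE : (n - 1 * (q ^ 2 - q - 1).+1 = q.+1)%N by rewrite /n; nia.
(* At [t = 0] the code itself bounds [kopt]; at [t = 1] the sum is [(q^2 - q - 1) + (q - 2)], the
   dimension; from [t = 2] on, the first summand alone suffices. *)
split=> [|[|[|t]]].
- by exists 1%N; rewrite nE kE; nia.
- rewrite mul0n subn0 add0n -code_dim_ovoid.
  by apply: leq_kopt; [exact: linear_parity_code|exact: wt_ge4].
- by rewrite nE kE; nia.
- nia.
Qed.
End OvoidCode.

(** * Scalars and nonroots in a finite extension *)

Lemma card_finvect (F : finFieldType) (L : fieldExtType F) :
  #|finvect_type L| = (#|F| ^ \dim {:L})%N.
Proof.
pose V : vectType F := finvect_type L.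
by rewrite -(@card_vspacef F (finvect_type L) (Vector.class V)) card_vspace.
Qed.

Lemma expf_cardL (F : finFieldType) (L : fieldExtType F) (x : L) :
  x ^+ (#|F| ^ \dim {:L}) = x.
Proof. by rewrite -card_finvect; apply: (@expf_card (finvect_type L)). Qed.

Lemma exists_nonroot (F : finFieldType) (L : fieldExtType F) (P : {poly L}) :
  P != 0 -> (size P <= #|F| ^ \dim {:L})%N -> exists x, P.[x] != 0.
Proof.
move=> P0; rewrite -card_finvect => leP.
have [/hasP[x _ Px]|] := boolP (has (fun x : L => P.[x] != 0) (enum (finvect_type L))).
  by exists x.
rewrite -all_predC => allP.
have := max_poly_roots (rs := enum (finvect_type L)) P0 _ (enum_uniq _).
rewrite -cardE ltnNge leP => /(_ _)/notF[] //.
by apply: sub_all allP => x /=; rewrite negbK.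
Qed.

(** [X^#|F| - X] already splits over [F], so its roots in [L] are scalars. *)
Lemma in_alg_expf_card (F : finFieldType) (L : fieldExtType F) (x : L) :
  x ^+ #|F| = x -> exists c : F, c%:A = x.
Proof.
move=> xF; have: root ('X^#|F| - 'X) x by rewrite rootE !hornerE xF subrr.
have -> : ('X^#|F| - 'X : {poly L}) = map_poly (in_alg L) ('X^#|F| - 'X).
  by rewrite rmorphB /= map_polyXn map_polyX.
rewrite finField_genPoly rmorph_prod /= rootE horner_prod prodf_seq_eq0.
by case/hasP=> c _; rewrite /= map_polyXsubC hornerXsubC subr_eq0 => /eqP ->; exists c.
Qed.

(** * Constacyclic codes and their duals *)

(** Up to a scalar the geometric sum is [(X^n - mu) / (X - b)]. It puts the sequence of powers of
    [b^-1] into the code, over [L], with check polynomial [h]. *)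
Lemma dvdp_geometric (L : fieldType) n (mu : L) (h : {poly L}) b : (0 < n)%N ->
  mu != 0 -> h %| 'X^n - mu%:P -> root h b -> b ^+ n = mu ->
  ('X^n - mu%:P) %/ h %| \poly_(i < n) b ^- i.
Proof.
move=> n_gt0 mu0 hX /factor_theorem[h' hE] bn; set S := \poly_(i < n) _.
have b0 : b != 0 by apply: contraNneq mu0 => b0; rewrite -bn b0 expr0n eqn0Ngt n_gt0.
have XS : 'X^n - mu%:P = (mu * b^-1) *: S * ('X - b%:P).
  have := subrX1 (b^-1 *: 'X) n; rewrite exprZn exprVn bn.
  have -> : \sum_(i < n) (b^-1 *: 'X) ^+ i = S.
    by rewrite /S poly_def; apply: eq_bigr => i _; rewrite exprZn exprVn.
  have -> : b^-1 *: 'X - 1 = b^-1 *: ('X - b%:P).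
    by rewrite scalerBr -[_ *: b%:P]mul_polyC -polyCM mulVf.
  move=> /(congr1 (fun p => mu *: p)); rewrite scalerBr scalerA mulfV // scale1r alg_polyC => ->.
  by rewrite -!scalerAl scalerA [_ * S]mulrC.
have SE : (mu * b^-1) *: S = ('X^n - mu%:P) %/ h * h'.
  have Xb0 : 'X - b%:P != 0 by rewrite polyXsubC_eq0.
  by apply: (mulIf Xb0); rewrite -XS -mulrA -hE divpK.
rewrite -(@dvdpZr _ (mu * b^-1)) ?mulf_neq0 ?invr_eq0 // SE dvdp_mulr //.
Qed.

(* [c] is divisible by [('X^n - lam) / h] and the reversal of [x] by [h], so their product is a
   multiple of ['X^n - lam] of degree at most [2 n - 2]; its coefficient of degree [n - 1], which is
   the scalar product of [x] and [c], therefore vanishes. *)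
Lemma mem_dual_constacyclic (F : finFieldType) (L : fieldExtType F) n (lam : F) (h : {poly L})
  (x : 'rV[F]_n) : (0 < n)%N -> h %| 'X^n - (lam%:A)%:P ->
  h %| map_poly (in_alg L) (\poly_(i < n) (rVpoly x)`_(n.-1 - i)) ->
  x \in dual_code (constacyclic_code n lam h).
Proof.
set xr := \poly_(i < n) _ => n_gt0 hX /dvdpP[a xE].
rewrite inE; apply/forall_inP=> c; rewrite inE => /dvdpP[b cE].
set C := rVpoly c in cE.
have prodE : map_poly (in_alg L) (xr * C) = a * b * ('X^n - (lam%:A)%:P).
  by rewrite rmorphM /= xE cE mulrACA [h * _]mulrC divpK.
have -> : (x *m c^T) 0 0 = (xr * C)`_n.-1.
  rewrite coefMr mxE prednK //.
  apply: eq_bigr => i _; rewrite mxE.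
  have lti := ltn_ord i; have lei : (i <= n.-1)%N by rewrite -ltnS prednK.
  rewrite coef_poly subKn // ifT; last by lia.
  by rewrite /C !coef_rVpoly_ord.
apply/eqP/(fmorph_inj (in_alg L)); rewrite -coef_map prodE rmorph0.
have sX := size_XnsubC (lam%:A : L) n_gt0.
have [->|ab0] := eqVneq (a * b) 0; first by rewrite mul0r coef0.
have szab : (size (a * b)%R <= n.-1)%N.
  have : (size (map_poly (in_alg L) (xr * C)%R) <= (n + n).-1)%N.
    rewrite size_map_poly; apply: leq_trans (size_polyMleq _ _) _.
    by rewrite -!subn1 leq_sub2r // leq_add //; apply: size_poly.
  rewrite prodE size_mul ?sX //; last by rewrite -size_poly_eq0 sX.
  by move: (size _) => k; lia.
rewrite mulrBr coefB coefMXn ifT; last by rewrite ltn_predL.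
by rewrite coefMC nth_default // mul0r subrr.
Qed.

(** * The trace of a quadratic extension *)

Section Trace.
Variables (F : finFieldType) (L : fieldExtType F).
Hypothesis dimL : \dim {:L} = 2%N.
Let Q := #|F|.
Hypothesis charQ : [pchar L].-nat Q.

(** As [x + x ^+ Q] is fixed by the [Q]-th power map, it is a scalar, which [pick] recovers; the
    default 0 is then never taken. *)
Definition trL (x : L) : F := odflt 0 [pick c : F | c%:A == x + x ^+ Q].

Lemma trLE x : (trL x)%:A = x + x ^+ Q.
Proof.
rewrite /trL; case: pickP => [c /eqP //|noc].
have [|c cE] := @in_alg_expf_card F L (x + x ^+ Q); last by move: (noc c); rewrite cE eqxx.
rewrite -/Q (exprDn_pchar _ _ charQ) -exprM addrC; congr (_ + _).
by have := expf_cardL _ _ x; rewrite dimL expnS expn1.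
Qed.

Lemma trL_is_scalar : scalar trL.
Proof.
move=> a x y; apply: (fmorph_inj (in_alg L)); rewrite rmorphD rmorphM /= !trLE.
rewrite (exprDn_pchar _ _ charQ) exprZn expf_card -[_ *: x]mulr_algl -[_ *: x ^+ Q]mulr_algl.
ring.
Qed.

(** [X^Q + X] has degree below [Q^2], so some [t] has nonzero trace; then [a = t / x] is a witness
    against [x != 0]. *)
Lemma trL_nondegenerate x : (forall a, trL (a * x) = 0) -> x = 0.
Proof.
move=> tr0; apply/eqP; apply: contraT => x0.
have Q_gt1 : (1 < Q)%N by exact: finNzRing_gt1.
have [|//|t] := @exists_nonroot F L ('X^Q + 'X).
- apply: contraTneq isT => /(congr1 (fun p : {poly L} => p`_1)) /eqP.
  by rewrite coefD coefXn coefX coef0 (ltn_eqF Q_gt1) add0r oner_eq0.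
- rewrite dimL; apply: leq_trans (size_polyD _ _) _.
  by rewrite size_polyXn size_polyX geq_max; nia.
rewrite !hornerE -[_ + t]addrC -trLE.
by have := tr0 (t / x); rewrite divfK // => ->; rewrite scale0r eqxx.
Qed.
End Trace.

(** * Section polynomials and their zeros among the [n]-th roots of unity *)

Section SectionPolynomial.
Variables (L : fieldType) (q n : nat) (om : L).
Hypothesis charq : [pchar L].-nat q.
Hypothesis q_gt2 : (2 < q)%N.
Hypothesis nE : n = (q ^ 2 + 1)%N.
Hypothesis prim_om : n.-primitive_root om.

(** The zeros at powers of [om] are the points of an ovoid lying in a plane. [A ^+ q ^+ q] is the
    conjugate [A^(q^2)]. *)
Definition sec_poly (A B : L) : {poly L} :=
  A%:P + B%:P * 'X + (B ^+ q ^+ q)%:P * 'X^q + (A ^+ q ^+ q)%:P * 'X^(q.+1).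

Lemma horner_sec_poly A B x : (sec_poly A B).[x] =
  A + B * x + B ^+ q ^+ q * x ^+ q + A ^+ q ^+ q * x ^+ q.+1.
Proof. by rewrite /sec_poly !hornerE. Qed.

Lemma coef_sec_poly A B i : (sec_poly A B)`_i =
  A *+ (i == 0)%N + B *+ (i == 1)%N + B ^+ q ^+ q *+ (i == q) + A ^+ q ^+ q *+ (i == q.+1).
Proof.
rewrite /sec_poly !coefD !coefCM coefC coefX !coefXn !mulr_natr.
by case: (i == 0)%N; rewrite ?mulr1n ?mulr0n.
Qed.

Lemma size_sec_poly A B : (size (sec_poly A B) <= q.+2)%N.
Proof.
apply/leq_sizeP => i lti; rewrite coef_sec_poly.
by do 4![rewrite (_ : (i == _) = false) ?mulr0n ?addr0; last by apply/eqP; lia].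
Qed.

Lemma sec_poly_eq0 A B : sec_poly A B = 0 -> A = 0 /\ B = 0.
Proof.
have [q0 q1 qS] : [/\ (0 == q)%N = false, (1 == q)%N = false & (1 == q.+1)%N = false].
  by split; apply/negbTE; lia.
move=> P0; have := coef_sec_poly A B 0; have := coef_sec_poly A B 1.
by rewrite P0 !coef0 q0 q1 qS !mulr0n !addr0 add0r !mulr1n => <- <-.
Qed.

Lemma om_inj : injective (fun i : 'I_n => om ^+ i).
Proof.
move=> i j /eqP; rewrite (eq_prim_root_expr prim_om) !modn_small // => /eqP.
exact: val_inj.
Qed.

Lemma sec_poly_zeros_le A B : (A, B) != (0, 0) ->
  (#|[set i : 'I_n | (sec_poly A B).[om ^+ i] == 0%R]| <= q.+1)%N.
Proof.
move=> AB0; set Z := [set i | _].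
have P0 : sec_poly A B != 0.
  by apply: contraNneq AB0 => /sec_poly_eq0[-> ->].
have /(max_poly_roots P0) : all (root (sec_poly A B)) [seq om ^+ (i : 'I_n) | i <- enum Z].
  by apply/allP=> _ /mapP[i + ->]; rewrite mem_enum inE.
rewrite (map_inj_uniq om_inj) enum_uniq size_map -cardE.
by move=> /(_ isT) ltZ; rewrite -ltnS (leq_trans ltZ) ?size_sec_poly.
Qed.

(* Where [P := sec_poly w (w ^+ q)] vanishes, [v ^+ q] is a Moebius transform of [v]; applying it twice
   gives [v ^+ (q ^ 2) = v^-1]. *)
Lemma sec_poly_dvdp w : w ^+ (q ^ 4) = w -> w ^+ (q + q ^ 3) != w ^+ (1 + q ^ 2) ->
  sec_poly w (w ^+ q) %| 'X^n - 1.
Proof.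
move=> w4 D0.
have w3q : w ^+ q ^+ q ^+ q ^+ q = w by rewrite -[RHS]w4 -!exprM !expnS expn0 !muln1 !mulnA.
set w1 := w ^+ q in w3q *; set w2 := w1 ^+ q in w3q *; set w3 := w2 ^+ q in w3q *.
(* Up to sign, the determinant of the Moebius transformation. *)
pose D := w1 * w3 - w * w2.
have D0' : D != 0.
  rewrite subr_eq0; apply: contra D0; rewrite /w3 /w2 /w1 -!exprM -exprS -exprD.
  by rewrite !expnS expn0 !muln1 !mulnA add1n.
set P := sec_poly _ _.
have PE : P = w%:P + w1%:P * 'X + (w3%:P + w2%:P * 'X) * 'X^q.
  by rewrite /P /sec_poly -/w1 -/w2 -/w3 exprS; ring.
have charP : [pchar {poly L}].-nat q by rewrite (eq_pnat _ (pchar_poly L)).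
have Pq : P ^+ q = w1%:P + w2%:P * 'X^q + (w%:P + w3%:P * 'X^q) * 'X^(q ^ 2).
  rewrite PE !(exprDn_pchar _ _ charP) !exprMn !(exprDn_pchar _ _ charP) !exprMn.
  by rewrite -!polyC_exp -['X^q ^+ q]exprM mulnn w3q.
rewrite -(@dvdpZr _ D) //.
(* Modulo [P], [(w3 + w2 X) X^q] equals [- (w + w1 X)]; substituting this in [(w3 + w2 X) P^q]
   leaves [D (1 - X^n)]. *)
have -> : D *: ('X^n - 1) = P * (w3%:P * 'X^(q^2) + w2%:P - (w3%:P + w2%:P * 'X) * P ^+ q.-1).
  rewrite mulrBr [P * (_ * _)]mulrCA -exprS prednK ?(ltnW (ltnW q_gt2)) // Pq PE.
  rewrite nE addn1 exprS -mul_polyC /D !rmorphB !rmorphM /=.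
  ring.
exact: dvdp_mulr.
Qed.

(** [P] has degree exactly [q + 1], with leading coefficient [w^(q^2)]. The cofactor of [P] in
    [X^n - 1] vanishes at every root of unity that [P] misses, so [P] misses at most [n - q - 1]. *)
Lemma sec_poly_zeros_ge w : w != 0 -> w ^+ (q ^ 4) = w -> w ^+ (q + q ^ 3) != w ^+ (1 + q ^ 2) ->
  (q.+1 <= #|[set i : 'I_n | (sec_poly w (w ^+ q)).[om ^+ i] == 0%R]|)%N.
Proof.
move=> w0 w4 D0; have /dvdpP[R XE] := sec_poly_dvdp w w4 D0.
set P := sec_poly _ _ in XE *; set Z := [set i | _].
have n_gt0 : (0 < n)%N by rewrite nE addn1.
have sX := size_Xn_sub_1 L n_gt0.
have RP0 : R * P != 0 by rewrite -XE -size_poly_eq0 sX.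
move: (RP0); rewrite mulf_eq0 negb_or => /andP[R0 P0].
have sP : size P = q.+2.
  apply/eqP; rewrite eqn_leq size_sec_poly ltnNge /=.
  apply/negP=> /leq_sizeP/(_ q.+1 (leqnn _))/eqP; rewrite coef_sec_poly eqxx mulr1n.
  do 3![rewrite (_ : (q.+1 == _) = false) ?mulr0n ?add0r; last by apply/eqP; lia].
  by rewrite -exprM expf_eq0 (negbTE w0) andbF.
have sR : (size R + q.+1 = n.+1)%N.
  by have := size_mul R0 P0; rewrite -XE sX sP addnS => ->.
have /(max_poly_roots R0) : all (root R) [seq om ^+ (i : 'I_n) | i <- enum (~: Z)].
  apply/allP=> _ /mapP[i + ->]; rewrite mem_enum !inE => Pi.
  have: root (R * P) (om ^+ i).
    by rewrite -XE rootE !hornerE -exprM mulnC exprM (prim_expr_order prim_om) expr1n subrr.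
  by rewrite rootM => /orP[//|]; rewrite rootE (negbTE Pi).
rewrite (map_inj_uniq om_inj) enum_uniq size_map -cardE.
move=> /(_ isT); have := cardsC Z; rewrite card_ord -/Z; move: #|Z| #|_| (size R) sR => a b c; lia.
Qed.

End SectionPolynomial.

(** * The constacyclic code as an ovoid code *)

Section ConstacyclicOvoid.
Variables (F : finFieldType) (L : fieldExtType F) (q : nat) (y om : L).
Let n := (q ^ 2 + 1)%N.
Hypothesis cardF : #|F| = (q ^ 2)%N.
Hypothesis dimL : \dim {:L} = 2%N.
Hypothesis charq : [pchar L].-nat q.
Hypothesis q_gt2 : (2 < q)%N.
Hypothesis prim_om : n.-primitive_root om.
Hypothesis y0 : y != 0.
Hypothesis y_conj : y ^+ (q ^ 2) = y * om ^+ q.+1.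
Hypothesis yom_conj : (y * om) ^+ (q ^ 2) = y * om ^+ q.

Definition tr : L -> F := trL F L.

Lemma pchar_pnat_card : [pchar L].-nat #|F|.
Proof. by rewrite cardF pnatX charq. Qed.

Let trE x : (tr x)%:A = x + x ^+ (q ^ 2).
Proof. by rewrite -cardF; apply: trLE; rewrite ?pchar_pnat_card. Qed.

HB.instance Definition _ := GRing.isLinear.Build F L F _ tr (trL_is_scalar F L dimL pchar_pnat_card).

Let om0 : om != 0.
Proof.
apply: contraTneq isT => om0; have := prim_expr_order prim_om.
by rewrite om0 expr0n /n addn1 => /esym/eqP; rewrite oner_eq0.
Qed.

Let d := \dim {:L}.

(* [basis_comb] identifies [F^d] with [L]; thus the columns of [ovoid_mx] below span the words
   [tr (A * y ^+ i + B * (y * om) ^+ i)] with [A] and [B] in [L]. *)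
Definition basis_comb (u : 'cV[F]_d) : L := \sum_j u j 0%R *: (vbasis {:L})`_j.

Lemma basis_comb_inj u : basis_comb u = 0 -> u = 0.
Proof.
move=> u0; apply/colP=> j.
have := coord_sum_free (fun j => u j 0) j (basis_free (vbasisP {:L})).
by rewrite -/(basis_comb u) u0 linear0 mxE.
Qed.

Lemma basis_comb_surj x : exists u, basis_comb u = x.
Proof.
exists (\col_j coord (vbasis {:L}) j x).
by rewrite [RHS](coord_vbasis (memvf x)); apply: eq_bigr => j _; rewrite mxE.
Qed.

Definition tr_mx (z : L) : 'M[F]_(n, d) := \matrix_(i, j) tr ((vbasis {:L})`_j * z ^+ i).

Lemma mul_tr_mx z u i : (tr_mx z *m u) i 0 = tr (basis_comb u * z ^+ i).
Proof.
rewrite mxE mulr_suml linear_sum; apply: eq_bigr => j _.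
by rewrite mxE -scalerAl linearZ /= mulrC.
Qed.

Definition ovoid_mx : 'M[F]_(n, d + d) := row_mx (tr_mx y) (tr_mx (y * om)).

(** The conjugate terms of the two traces supply the exponents [q + 1] and [q], and [y ^+ i] factors
    out. *)
Lemma mul_ovoid_mx u i : ((ovoid_mx *m u) i 0)%:A =
  y ^+ i * (sec_poly L q (basis_comb (usubmx u)) (basis_comb (dsubmx u))).[om ^+ i].
Proof.
set A := basis_comb _; set B := basis_comb _.
have conjM (a z : L) : (a * z ^+ i) ^+ (q ^ 2) = a ^+ q ^+ q * (z ^+ (q ^ 2)) ^+ i.
  by rewrite exprMn exprAC -[a ^+ q ^+ q]exprM mulnn.
rewrite -{1}[u]vsubmxK mul_row_col mxE !mul_tr_mx scalerDl !trE horner_sec_poly !conjM.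
rewrite y_conj yom_conj !exprMn ![om ^+ i ^+ _]exprAC.
rewrite -/A -/B; ring.
Qed.

Lemma ovoid_mx_zeros (u : 'cV_(d + d)) : [set i | (ovoid_mx *m u) i 0%R == 0%R] =
  [set i : 'I_n | (sec_poly L q (basis_comb (usubmx u)) (basis_comb (dsubmx u))).[om ^+ i] == 0].
Proof.
apply/setP=> i; rewrite !inE -(fmorph_eq0 (in_alg L)) /= mul_ovoid_mx mulf_eq0.
by rewrite expf_eq0 (negbTE y0) andbF.
Qed.

Lemma ovoid_zeros_le (u : 'cV_(d + d)) : u != 0 -> (#|[set i | (ovoid_mx *m u) i 0%R == 0%R]| <= q.+1)%N.
Proof.
move=> u0; rewrite ovoid_mx_zeros; apply: sec_poly_zeros_le => //.
apply: contraNneq u0 => -[/basis_comb_inj u1 /basis_comb_inj u2].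
by rewrite -[u]vsubmxK u1 u2 col_mx0.
Qed.

(** A suitable [w] exists by counting: the value of [sec_poly w (w ^+ q)] at [c] and the
    nondegeneracy condition are the polynomials [W1] and [W2] in [w], and their product has degree
    at most [2 q^3 + q], less than [q^4], the size of [L], since [q > 2]. *)
Lemma ovoid_zeros_ge (i : 'I_n) : exists u : 'cV_(d + d), (ovoid_mx *m u) i 0%R != 0%R /\
  (q.+1 <= #|[set i | (ovoid_mx *m u) i 0%R == 0%R]|)%N.
Proof.
pose c := om ^+ i; have c0 : c != 0 by rewrite expf_neq0.
pose W1 : {poly L} := 'X + c%:P * 'X^q + (c ^+ q)%:P * 'X^(q ^ 3) + (c ^+ q.+1)%:P * 'X^(q ^ 2).
pose W2 : {poly L} := 'X^(q + q ^ 3) - 'X^(1 + q ^ 2).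
have [q1 q2 q3] : [/\ (1 < q)%N, (q < q ^ 2)%N & (q ^ 2 < q ^ 3)%N].
  by split; rewrite ?(ltnW q_gt2) // -{1}[q]expn1 ltn_exp2l ?(ltnW q_gt2).
have W10 : W1 != 0.
  apply: contraTneq isT => /(congr1 (fun p : {poly L} => p`_1)) /eqP.
  rewrite !coefD !coefCM coefX !coefXn coef0 (ltn_eqF q1) (ltn_eqF (ltn_trans q1 q2)).
  by rewrite (ltn_eqF (ltn_trans (ltn_trans q1 q2) q3)) !mulr0 !addr0 oner_eq0.
have W20 : W2 != 0.
  rewrite subr_eq0; apply: contraTneq isT => /(congr1 (size : {poly L} -> nat)).
  rewrite !size_polyXn; lia.
have szZX (a : L) k : (k <= q ^ 3)%N -> (size (a%:P * 'X^k)%R <= (q ^ 3).+1)%N.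
  by move=> lek; rewrite mul_polyC (leq_trans (size_scale_leq _ _)) // size_polyXn.
have szW1 : (size W1 <= (q ^ 3).+1)%N.
  do ![apply: leq_trans (size_polyD _ _) _; rewrite geq_max; apply/andP; split];
    rewrite ?szZX ?size_polyX //; lia.
have szW2 : (size W2 <= (q + q ^ 3).+1)%N.
  by apply: leq_trans (size_polyD _ _) _; rewrite size_polyN !size_polyXn; lia.
have [||w] := @exists_nonroot F L (W1 * W2); first by rewrite mulf_neq0.
  apply: leq_trans (size_polyMleq _ _) _; rewrite dimL cardF -expnM.
  have : (q ^ (2 * 2) = q * q ^ 3)%N by rewrite -expnS.
  move: (size W1) (size W2) szW1 szW2 => s1 s2 h1 h2 ->; nia.
rewrite hornerM mulf_eq0 negb_or => /andP[W1w W2w].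
have w4 : w ^+ (q ^ 4) = w by have := expf_cardL F L w; rewrite dimL cardF -expnM.
have D0 : w ^+ (q + q ^ 3) != w ^+ (1 + q ^ 2).
  by move: W2w; rewrite !hornerE subr_eq0.
have w0 : w != 0 by apply: contraNneq D0 => ->; rewrite !expr0n !addn_eq0 (gtn_eqF (ltnW q1)).
have [u1 u1E] := basis_comb_surj w; have [u2 u2E] := basis_comb_surj (w ^+ q).
exists (col_mx u1 u2); split; last first.
  rewrite ovoid_mx_zeros col_mxKu col_mxKd u1E u2E.
  exact: sec_poly_zeros_ge.
rewrite -(fmorph_eq0 (in_alg L)) /= mul_ovoid_mx col_mxKu col_mxKd u1E u2E mulf_neq0 ?expf_neq0 //.
move: W1w; rewrite horner_sec_poly !hornerE -/c; apply: contra_neq => <-.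
rewrite -!exprM !expnS expn0 !muln1; ring.
Qed.

(** The trace form is nondegenerate, so testing the sum against a basis of [L] over [F] detects
    whether it vanishes. *)
Lemma mul_row_tr_mx (x : 'rV_n) z : x *m tr_mx z = 0 <-> \sum_i x 0 i *: z ^+ i = 0.
Proof.
have xu u : (x *m (tr_mx z *m u)) 0 0 = tr (basis_comb u * \sum_i x 0 i *: z ^+ i).
  rewrite mxE mulr_sumr linear_sum; apply: eq_bigr => i _.
  by rewrite mul_tr_mx -scalerAr linearZ.
split=> [xz|xz].
  apply: (trL_nondegenerate F L dimL pchar_pnat_card) => a; have [u <-] := basis_comb_surj a.
  by rewrite -[LHS]xu mulmxA xz mul0mx mxE.
apply/rowP=> j; have := xu (delta_mx j 0).
by rewrite xz mulr0 linear0 mulmxA -colE !mxE.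
Qed.

Let es := [:: 0; 1; q; q.+1]%N.

(** The power map [t ^+ (q ^ 2)] fixes the entries of [x] and takes the check for [e = 0] to that
    for [q + 1], and the one for 1 to that for [q]. *)
Lemma mem_parity_ovoid (x : 'rV_n) : x \in parity_code ovoid_mx <->
  (forall e, e \in es -> \sum_i x 0 i *: (y * om ^+ e) ^+ i = 0).
Proof.
have -> : (x \in parity_code ovoid_mx) <-> x *m tr_mx y = 0 /\ x *m tr_mx (y * om) = 0.
  rewrite inE mul_mx_row; split=> [/eqP|[-> ->]]; last by rewrite row_mx0.
  by rewrite -[0]row_mx0 => /eq_row_mx.
rewrite !mul_row_tr_mx; split=> [[x0 x1]|xe]; last first.
  by split; [have := xe 0%N | have := xe 1%N]; rewrite ?mulr1 ?expr1; apply; rewrite !inE.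
have conj (z : L) : (\sum_i x 0 i *: z ^+ i) ^+ (q ^ 2) = \sum_i x 0 i *: (z ^+ (q ^ 2)) ^+ i.
  rewrite (big_morph (fun t : L => t ^+ (q ^ 2)) (id1 := 0) (op1 := +%R)).
  - by apply: eq_bigr => i _; rewrite exprZn exprAC -cardF expf_card.
  - by move=> a b /=; apply: exprDn_pchar; rewrite pnatX charq.
  - by rewrite expr0n; case: q q_gt2.
move=> e; rewrite !inE => /or4P[] /eqP ->; rewrite ?mulr1 ?expr1 //.
  by rewrite -yom_conj -conj x1 expr0n; case: q q_gt2.
by rewrite -y_conj -conj x0 expr0n; case: q q_gt2.
Qed.

(* For [x] of weight at most 3, choose [a] and [b] so that [(om ^+ j - a) * (om ^+ j - b) ^+ q] vanishes
   on the support of [x] except at one index [i]; expanding the product in the exponents [es] turns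
   the four parity checks into [x 0 i = 0]. *)
Lemma ovoid_wt_ge4 (x : 'rV_n) : x \in parity_code ovoid_mx -> x != 0 -> (4 <= wt x)%N.
Proof.
move=> /mem_parity_ovoid xe /rV0Pn[i xi]; rewrite leqNgt; apply/negP=> ltx.
(* One choice of [a] removes one index from [T]; when [T] is empty, [a = 0] serves, being different
   from [om ^+ i]. *)
have cover (T : {set 'I_n}) : i \notin T -> exists a (T' : {set 'I_n}),
    [/\ a != om ^+ i, i \notin T', (#|T'| <= #|T|.-1)%N &
        forall j, j \in T -> j \in T' \/ om ^+ j = a].
  move=> iT; have [T0|[k kT]] := set_0Vmem T.
    by exists 0, T; rewrite T0 cards0 eq_sym expf_neq0 // inE; split=> // j; rewrite inE.
  exists (om ^+ k), (T :\ k); split.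
  - by apply: contraNneq iT => /(om_inj L n om prim_om) <-.
  - by rewrite !inE (negbTE iT) andbF.
  - by rewrite (cardsD1 k T) kT.
  - by move=> j jT; rewrite !inE jT andbT; case: eqVneq => [->|]; [right|left].
pose S := [set j | x 0 j != 0] :\ i.
have [|a [S' [ai iS' leS' aS]]] := cover S; first by rewrite !inE eqxx.
have [b [S'' [bi iS'' leS'' bS]]] := cover S' iS'.
have S''0 : S'' = set0.
  apply/eqP; rewrite -cards_eq0.
  have : (#|S|.+1 <= 3)%N by move: ltx; rewrite /wt (cardsD1 i) inE xi add1n.
  move: #|S| #|S'| #|S''| leS' leS'' => s1 s2 s3; lia.
pose T (j : 'I_n) : L := (om ^+ j - a) * (om ^+ j - b) ^+ q.
have TE j : T j = om ^+ q.+1 ^+ j - b ^+ q * om ^+ j - a * om ^+ q ^+ j + a * b ^+ q.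
  rewrite /T (exprDn_pchar _ _ charq) (exprNn_pchar _ charq) ![om ^+ _ ^+ j]exprAC exprS; ring.
have sum0 : \sum_j x 0 j *: (y ^+ j * T j) = 0.
  transitivity (\sum_j x 0 j *: (y * om ^+ q.+1) ^+ j - b ^+ q * (\sum_j x 0 j *: (y * om ^+ 1) ^+ j)
    - a * (\sum_j x 0 j *: (y * om ^+ q) ^+ j) + a * b ^+ q * (\sum_j x 0 j *: (y * om ^+ 0) ^+ j)).
    rewrite !mulr_sumr -!sumrB -big_split; apply: eq_bigr => j _ /=.
    rewrite -!scalerAr -!scalerBr -scalerDr; congr (_ *: _).
    rewrite TE expr0 mulr1 expr1 !exprMn; ring.
  by rewrite !xe ?inE ?eqxx ?orbT // !mulr0 !subr0 addr0.
have : x 0 i *: (y ^+ i * T i) = 0.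
  rewrite -[RHS]sum0 (bigD1 i) //= big1 ?addr0 // => j ji.
  have [->|xj] := eqVneq (x 0 j) 0; first by rewrite scale0r.
  rewrite /T; have [|/bS[]|->] := aS j _; first by rewrite !inE ji.
  - by rewrite S''0 inE.
  - by move=> ->; rewrite subrr expr0n gtn_eqF ?mulr0 ?scaler0 // (ltnW (ltnW q_gt2)).
  - by rewrite subrr mul0r mulr0 scaler0.
apply/eqP; rewrite scaler_eq0 negb_or xi !mulf_neq0 ?expf_neq0 // subr_eq0 eq_sym //.
Qed.

Variable lam : F.
Hypothesis y_lam : y^-1 ^+ n = lam%:A.

(* For [y = delta^-1] the four roots are [delta], [delta ^+ (q ^ 2)] and their counterparts for
   the second zero of the check polynomial. *)
Definition ovoid_check_poly : {poly L} := \prod_(e <- es) ('X - ((y * om ^+ e)^-1)%:P).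

Let roots := [seq (y * om ^+ e)^-1 | e <- es].

Let ovoid_check_polyE : ovoid_check_poly = \prod_(b <- roots) ('X - b%:P).
Proof. by rewrite big_map. Qed.

Let n_gt0 : (0 < n)%N.
Proof. by rewrite /n addn1. Qed.

Let uniq_rts : uniq_roots roots.
Proof.
rewrite uniq_rootsE map_inj_in_uniq.
  rewrite /= !inE; lia.
have ltn e : e \in es -> (e < n)%N.
  by rewrite !inE /n => /or4P[] /eqP ->; nia.
move=> e e' /ltn lte /ltn lte' /invr_inj/(mulfI y0)/eqP.
by rewrite (eq_prim_root_expr prim_om) !modn_small // => /eqP.
Qed.

Let roots_exp e : (y * om ^+ e)^-1 ^+ n = lam%:A.
Proof.
by rewrite exprVn exprMn exprAC (prim_expr_order prim_om) expr1n mulr1 -exprVn y_lam.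
Qed.

Let dvdp_check : ovoid_check_poly %| 'X^n - (lam%:A)%:P.
Proof.
rewrite ovoid_check_polyE; apply: uniq_roots_dvdp uniq_rts.
by apply/allP=> _ /mapP[e _ ->]; rewrite rootE !hornerE roots_exp subrr.
Qed.

(** One inclusion holds because the reversal of a parity word vanishes at the roots of the check
    polynomial; the other because the columns of [ovoid_mx] are themselves words of the constacyclic
    code. *)
Lemma dual_ovoid_code : dual_code (constacyclic_code n lam ovoid_check_poly) = parity_code ovoid_mx.
Proof.
have lam0 : lam%:A != 0 :> L by rewrite -y_lam expf_neq0 ?invr_neq0.
apply/setP=> x; apply/idP/idP; last first.
  move=> /mem_parity_ovoid xe; apply: mem_dual_constacyclic => //.
  rewrite ovoid_check_polyE; apply: uniq_roots_dvdp uniq_rts.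
  apply/allP=> _ /mapP[e /xe x0 ->]; set z := y * _ in x0 *.
  have z0 : z != 0 by rewrite mulf_neq0 ?expf_neq0.
  have -> : map_poly (in_alg L) (\poly_(i < n) (rVpoly x)`_(n.-1 - i)) =
      \poly_(i < n) in_alg L (rVpoly x)`_(n.-1 - i).
    by apply/polyP=> k; rewrite coef_map !coef_poly; case: ifP => // _; rewrite /= scale0r.
  rewrite rootE horner_poly (reindex_inj rev_ord_inj) /=.
  (* Reversing the coefficients and evaluating at [z^-1] gives the value at [z] up to a power of
     [z]. *)
  apply/eqP; transitivity (z ^- n.-1 * \sum_i x 0 i *: z ^+ i); last by rewrite x0 mulr0.
  rewrite mulr_sumr; apply: eq_bigr => i _.
  have lti := ltn_ord i.
  rewrite (_ : n.-1 - (n - i.+1) = i)%N; last by lia.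
  rewrite coef_rVpoly_ord mulr_algl -scalerAr; congr (_ *: _).
  rewrite (_ : z ^- n.-1 = z ^- (n - i.+1) * z ^- i) ?mulfVK ?expf_neq0 ?exprVn //.
  by rewrite -invfM -exprD; congr (z ^- _); lia.
rewrite inE => /forall_inP xdual; rewrite inE; apply/eqP/rowP=> j.
pose u : 'cV[F]_(d + d) := delta_mx j 0.
have /xdual/eqP : (ovoid_mx *m u)^T \in constacyclic_code n lam ovoid_check_poly; last first.
  by rewrite trmxK mulmxA -colE mxE => ->; rewrite mxE.
set A := basis_comb (usubmx u); set B := basis_comb (dsubmx u).
pose S e : {poly L} := \poly_(i < n) (y * om ^+ e)^-1 ^- i.
rewrite inE; set g := _ %/ _.
have -> : map_poly (in_alg L) (rVpoly (ovoid_mx *m u)^T) =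
    A *: S 0 + B *: S 1 + B ^+ q ^+ q *: S q + A ^+ q ^+ q *: S q.+1.
  apply/polyP=> k; rewrite coef_map !coefD !coefZ !coef_poly.
  case: ltnP => [ltk|gek]; last first.
    by rewrite !mulr0 !addr0 /= scale0r.
  rewrite insubT /= mxE mul_ovoid_mx horner_sec_poly expr0 expr1 mulr1 !exprVn !invrK !exprMn.
  rewrite -/A -/B ![om ^+ _ ^+ k]exprAC; ring.
have gS e : e \in es -> g %| S e.
  move=> ee; apply: dvdp_geometric => //.
  by rewrite ovoid_check_polyE root_prod_XsubC; apply: map_f ee.
by do ![apply: dvdp_add]; rewrite -mul_polyC dvdp_mull ?gS // !inE ?eqxx ?orbT.
Qed.

End ConstacyclicOvoid.

Lemma constacyclic_ovoid_optimal (F : finFieldType) (L : fieldExtType F) (q n : nat)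
    (y om : L) (lam : F) :
  #|F| = (q ^ 2)%N -> \dim {:L} = 2%N -> [pchar L].-nat q -> (2 < q)%N -> n = (q ^ 2 + 1)%N ->
  n.-primitive_root om -> y != 0 ->
  y ^+ (q ^ 2) = y * om ^+ q.+1 -> (y * om) ^+ (q ^ 2) = y * om ^+ q ->
  y^-1 ^+ n = lam%:A ->
  let K := dual_code (constacyclic_code n lam (ovoid_check_poly F L q y om)) in
  linear_code K /\
  exists d rl : nat,
    [/\ is_min_dist K d, is_min_locality K rl,
        distance_optimal n (code_dim K) d rl & dimension_optimal F n (code_dim K) d rl].
Proof.
move=> cardF dimL charq q_gt2 -> prim_om y0 y_conj yom_conj y_lam K.
have -> : K = parity_code (ovoid_mx F L q y om) by exact: dual_ovoid_code.
split; first exact: linear_parity_code.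
apply: ovoid_code_optimal => //; first by rewrite dimL.
- by move=> u; apply: ovoid_zeros_le.
- by move=> i; apply: ovoid_zeros_ge.
- by move=> x; apply: ovoid_wt_ge4.
Qed.

(** * Orders of roots of unity and the two families of codes *)

Lemma odd_cofactor r s : (0 < s)%N -> (r %| s)%N -> logn 2 r = logn 2 s -> odd (s %/ r).
Proof.
move=> s_gt0 rs lrs; rewrite -[odd _]negbK -dvdn2.
have t_gt0 : (0 < s %/ r)%N by rewrite divn_gt0 ?(dvdn_leq s_gt0 rs) // (dvdn_gt0 s_gt0 rs).
by rewrite -[2%N]expn1 pfactor_dvdn // logn_div // lrs subnn.
Qed.

(* The oddness of [s %/ r] is what the 2-adic hypothesis provides; it matters since
   [gcdn s n = gcdn s 2]. *)
Lemma gcdn_cofactor c k r s n : (0 < s)%N -> (r %| s)%N -> logn 2 r = logn 2 s ->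
  n = (k * s + 2)%N -> coprime c n -> gcdn (c * s) (r * n) = r.
Proof.
move=> s_gt0 rs lrs nE cn; have odd_t := odd_cofactor r s s_gt0 rs lrs.
have ks : (k * s = k * r * (s %/ r))%N by rewrite -{1}(divnK rs) mulnA mulnAC.
have cop : coprime (s %/ r) n by rewrite nE ks /coprime gcdnMDl -/(coprime _ 2) coprimen2.
rewrite -{1}(divnK rs) mulnA [(_ * r)%N]mulnC -muln_gcdr.
have /eqP -> : coprime (c * (s %/ r)) n by rewrite coprimeMl cn.
by rewrite muln1.
Qed.

Theorem theorem4p12 (p m q n : nat) (F : finFieldType) (L : fieldExtType F)
    (lam : F) (r : nat) (delta : L) (a b : nat) :
  prime p -> (0 < m)%N -> q = (p ^ m)%N -> (2 < q)%N -> n = (q ^ 2 + 1)%N ->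
  #|F| = (q ^ 2)%N -> \dim {:L} = 2%N ->
  r.-primitive_root lam ->
  (r * n)%N.-primitive_root delta -> delta ^+ n = lam%:A ->
  ((r %| q + 1)%N /\ logn 2 r = logn 2 (q + 1) /\
     a = (q ^ 2 + q + 1)%N /\ b = (q ^ 4 + q ^ 3 + q ^ 2)%N)
  \/
  ((r %| q - 1)%N /\ logn 2 r = logn 2 (q - 1) /\
     a = (q ^ 2 - q + 1)%N /\ b = (q ^ 4 - q ^ 3 + q ^ 2)%N) ->
  let Cperp := dual_code (constacyclic_code n lam (check_poly delta q a b)) in
  linear_code Cperp /\
  exists d rl : nat,
    [/\ is_min_dist Cperp d, is_min_locality Cperp rl,
        distance_optimal n (code_dim Cperp) d rl &
        dimension_optimal F n (code_dim Cperp) d rl].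
Proof.
move=> pr_p m_gt0 qE q_gt2 nE cardF dimL _ prim_delta delta_n cases.
have n_gt0 : (0 < n)%N by rewrite nE addn1.
have charq : [pchar L].-nat q.
  rewrite (eq_pnat _ (pchar_lalg L)) qE pnatX pnatE // (card_finPcharP (n := m * 2)) //.
  by rewrite cardF qE expnM.
have rn_gt0 := prim_order_gt0 prim_delta.
have delta0 : delta != 0.
  apply/eqP=> delta0; have := prim_expr_order prim_delta.
  by rewrite delta0 expr0n gtn_eqF // => /esym/eqP; rewrite oner_eq0.
pose y := delta^-1.
have y0 : y != 0 by rewrite invr_eq0.
have prim_y : (r * n).-primitive_root y.
  have -> : y = delta ^+ (r * n).-1.
    by apply: (mulfI delta0); rewrite mulfV // -exprS prednK ?prim_expr_order.
  by rewrite prim_root_exp_coprime // coprime_sym coprimenP.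
have y_lam : y^-1 ^+ n = lam%:A by rewrite invrK.
have y4 : y ^+ (q ^ 4) = y by have := expf_cardL F L y; rewrite dimL cardF -expnM.
have eqy i j : (r * n %| i)%N -> y ^+ (i + j) = y ^+ j.
  by move=> /dvdnP[k ->]; rewrite exprD mulnC exprM (prim_expr_order prim_y) expr1n mul1r.
have coprime_qn : coprime q n by rewrite nE -mulnn /coprime gcdnMDl gcdn1.
have prim_exp e : gcdn e (r * n) = r -> n.-primitive_root (y ^+ e).
  by have := exp_prim_root prim_y e => /[swap] ->; rewrite mulKn //; move: rn_gt0; rewrite muln_gt0 => /andP[].
have deltaE k : delta ^+ k = (y ^+ k)^-1 by rewrite exprVn invrK.
case: cases => [[r_dvd [r_log [-> ->]]]|[r_dvd [r_log [-> ->]]]].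
  (* The exponent is [a - 1], so that [delta ^+ a] is the root for [e = 1] and [delta ^+ b] the one
     for [e = q]. *)
  pose om := y ^+ (q * (q + 1)).
  have rn_dvd : (r * n %| (q + 1) * (q ^ 2 + 1))%N by rewrite nE dvdn_mul.
  have y_conj : y ^+ (q ^ 2) = y * om ^+ q.+1.
    rewrite -exprM -exprS -(eqy _ (q ^ 2)%N rn_dvd); congr (_ ^+ _); ring.
  have yom_conj : (y * om) ^+ (q ^ 2) = y * om ^+ q.
    rewrite -exprS -!exprM -exprS.
    rewrite (_ : _.+1 * q ^ 2 = q ^ 4 + (q ^ 3 + q ^ 2))%N; last by ring.
    by rewrite exprD y4 -exprS; congr (_ ^+ _); ring.
  have -> : check_poly delta q (q ^ 2 + q + 1) (q ^ 4 + q ^ 3 + q ^ 2) = ovoid_check_poly F L q y om.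
    rewrite /ovoid_check_poly !big_cons big_nil /check_poly !deltaE y_conj.
    have -> : y ^+ (q ^ 2 + q + 1) = y * om ^+ 1.
      by rewrite -exprM -exprS; congr (_ ^+ _); ring.
    have -> : y ^+ (q ^ 4 + q ^ 3 + q ^ 2) = y * om ^+ q.
      by rewrite -!addnA exprD y4 -exprM -!exprS; congr (_ ^+ _); ring.
    by rewrite expr0 mulr1 /y invrK; ring.
  apply: constacyclic_ovoid_optimal => //; apply: prim_exp.
  apply: (gcdn_cofactor _ (q - 1)) => //; first by rewrite addn1.
  by rewrite nE; nia.
(* Here the roles are exchanged: [a - 1 = q (q - 1)], so [delta ^+ a] is the root for [e = q] and
   [delta ^+ b] the one for [e = 1]. *)
pose om := y ^+ (q - 1).
have q_gt0 : (0 < q)%N by lia.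
have rn_dvd : (r * n %| (q - 1) * (q ^ 2 + 1))%N by rewrite nE dvdn_mul.
have y_om : y * om = y ^+ q by rewrite -exprS; congr (_ ^+ _); lia.
have y_conj : y ^+ (q ^ 2) = y * om ^+ q.+1.
  by rewrite -exprM -exprS; congr (_ ^+ _); nia.
have yom_conj : (y * om) ^+ (q ^ 2) = y * om ^+ q.
  rewrite y_om -!exprM -exprS -[RHS](eqy _ _ rn_dvd); congr (_ ^+ _); nia.
have -> : check_poly delta q (q ^ 2 - q + 1) (q ^ 4 - q ^ 3 + q ^ 2) = ovoid_check_poly F L q y om.
  rewrite /ovoid_check_poly !big_cons big_nil /check_poly !deltaE y_conj.
  have -> : y ^+ (q ^ 2 - q + 1) = y * om ^+ q.
    by rewrite -exprM -exprS; congr (_ ^+ _); nia.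
  have -> : y ^+ (q ^ 4 - q ^ 3 + q ^ 2) = y * om ^+ 1.
    (* Multiplying by [y ^+ (q ^ 3)] removes the truncated subtraction from the exponent. *)
    rewrite expr1 y_om; apply: (mulIf (expf_neq0 (q ^ 3) y0)); rewrite -!exprD.
    rewrite (_ : q ^ 4 - q ^ 3 + q ^ 2 + q ^ 3 = q ^ 4 + q ^ 2)%N; last first.
      have : (q ^ 3 <= q ^ 4)%N by rewrite leq_exp2l; lia.
      lia.
    rewrite exprD y4 -exprS -(eqy _ _ rn_dvd); congr (_ ^+ _); nia.
  by rewrite expr0 mulr1 /y invrK; ring.
apply: constacyclic_ovoid_optimal => //; apply: prim_exp.
rewrite -[(q - 1)%N]mul1n; apply: (gcdn_cofactor _ (q + 1)) => //; first by lia.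
- by rewrite nE; nia.
- exact: coprime1n.
Qed.
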